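(* Let $k \in \mathbb{N}$, let $m_1,m_2$ be integers with $1 \leq m_1 \leq m_2$, and let $\rho = \lceil (m_1+m_2+2)/k \rceil$. If $m_2 \leq \rho(k-1)-1$ and $m_1+m_2 \leq 15 + \rho(k-2)$, then the disjoint union $K_{1,m_1} + K_{1,m_2}$ is equitably $k$-choosable.
   Context: All graphs are finite and simple; $\mathbb{N}=\{1,2,3,\dots\}$. A list assignment $L$ for a graph $G$ assigns to each vertex $v$ a set $L(v)$ of colors; it is a $k$-assignment if $|L(v)|=k$ for all $v$. The palette of $L$ is $\bigcup_{v} L(v)$. A proper $L$-coloring is a proper coloring $f$ with $f(v)\in L(v)$ for all $v$. If $L$ is a $k$-assignment, an equitable $L$-coloring of $G$ is a proper $L$-coloring in which each color of the palette appears on at most $\lceil |V(G)|/k \rceil$ vertices. $G$ is equitably $k$-choosable if an equitable $L$-coloring exists for every $k$-assignment $L$ for $G$. *)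

(* Defs.v *)
From mathcomp Require Import all_boot all_order all_algebra.

Set Implicit Arguments.
Unset Strict Implicit.
Unset Printing Implicit Defensive.

Import Order.TTheory GRing.Theory Num.Theory.

Record sgraph := SGraph {
  vertex :> finType;
  adj : rel vertex;
  adj_sym : symmetric adj;
  adj_irrefl : irreflexive adj }.

Section CompleteBipartite.
Variables m n : nat.

Definition bipartite_adj : rel ('I_m + 'I_n) := fun x y =>
  match x, y with
  | inl _, inr _ | inr _, inl _ => true
  | _, _ => false
  end.

Fact bipartite_adj_sym : symmetric bipartite_adj.
Proof. by case=> [i|i] [j|j]. Qed.

Fact bipartite_adj_irrefl : irreflexive bipartite_adj.
Proof. by case. Qed.

Definition complete_bipartite : sgraph :=
  SGraph bipartite_adj_sym bipartite_adj_irrefl.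

End CompleteBipartite.

Section DisjointUnion.
Variables G H : sgraph.

Definition disjoint_union_adj : rel (G + H) := fun x y =>
  match x, y with
  | inl u, inl v => adj u v
  | inr u, inr v => adj u v
  | _, _ => false
  end.

Fact disjoint_union_adj_sym : symmetric disjoint_union_adj.
Proof. by case=> [u|u] [v|v] //=; apply: adj_sym. Qed.

Fact disjoint_union_adj_irrefl : irreflexive disjoint_union_adj.
Proof. by case=> u /=; apply: adj_irrefl. Qed.

Definition disjoint_union : sgraph :=
  SGraph disjoint_union_adj_sym disjoint_union_adj_irrefl.

End DisjointUnion.

Definition ceil_div (n k : nat) : int := Num.ceil (n%:R / k%:R : rat)%R.

(* Lists of a k-assignment are finite, hence so is the palette: letting the   *)
(* ambient set of colors C range over all finite types loses no generality.   *)
Section ListColoring.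
Variables (G : sgraph) (C : finType).
Implicit Types (L : G -> {set C}) (f : G -> C) (k : nat).

Definition k_assignment k L := forall v, #|L v| = k.

Definition palette L : {set C} := \bigcup_(v : G) L v.

Definition proper_list_coloring L f :=
  (forall u v, adj u v -> f u <> f v) /\ (forall v, f v \in L v).

Definition equitable_list_coloring k L f :=
  proper_list_coloring L f /\
  forall c, c \in palette L ->
    (#|[set v | f v == c]|%:Z <= ceil_div #|G| k)%R.

End ListColoring.

Definition equitably_choosable (k : nat) (G : sgraph) :=
  forall (C : finType) (L : G -> {set C}), k_assignment k L ->
    exists f : G -> C, equitable_list_coloring k L f.

(* Main.v *)
Require Import Defs.
From mathcomp Require Import all_boot all_order all_algebra.
From mathcomp Require Import zify.

Import GRing.Theory Num.Theory.

(* Once the centers have colors c1 and c2, the rest of the coloring is a system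
   of representatives with multiplicities at most rho, so Hall's condition
   decides whether it exists.  The bounds on m1 and m2 give the condition for
   every set S of colors except those with #|S| = k - 1 and c1, c2 \notin S,
   where the leaves confined to S are those with list c1 |: S around the first
   center and those with list c2 |: S around the second.  If every one of the
   k ^ 2 choices of (c1, c2) had a set S confining at least
   N = rho * (k - 1) + 1 leaves, summing over the choices would give
   k ^ 2 * N <= m1 + k ^ 2 * m2: a list around the first center and a list
   around the second are together counted at most k ^ 2 + 1 times.  But
   m1 + m2 <= N + 5 and m2 <= N - 2, whence 2 * (k ^ 2 - 1) <= 5, which is
   absurd for k >= 2. *)

(** * Hall's theorem with color capacities *)

Lemma card_sub_setUI (X C : finType) (l : X -> {set C}) (S T : {set C}) :
  #|[set x | l x \subset S]| + #|[set x | l x \subset T]| =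
  #|[set x | l x \subset S] :|: [set x | l x \subset T]|
  + #|[set x | l x \subset S :&: T]|.
Proof.
rewrite -cardsUI; congr (_ + #|pred_of_set _|).
by apply/setP=> x; rewrite !inE subsetI.
Qed.

(* Rado's argument: in a list with two colors one of them can be deleted, since
   otherwise the two violated conditions add up to a violation at [S :|: T]. *)
Lemma hall_capacity (X C : finType) (cap : C -> nat) (l : X -> {set C}) :
  (forall S : {set C},
     #|[set x | l x \subset S]| <= \sum_(c in S) cap c) ->
  exists f : X -> C, (forall x, f x \in l x) /\
    (forall c, #|[set x | f x == c]| <= cap c).
Proof.
have [n] := ubnP (\sum_x #|l x|); elim: n => // n IH in l * => ltn hall.
case: (boolP [exists x, 1 < #|l x|]) => [/existsP [x xl]|small]; last first.
  have l1 x : exists c, l x == [set c].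
    suff /cards1P [c ->] : #|l x| == 1 by exists c.
    have le1 : #|l x| <= 1.
      by rewrite leqNgt; move: small; rewrite negb_exists => /forallP.
    have : #|l x| != 0.
      rewrite cards_eq0; apply/eqP => l0; have := hall set0.
      rewrite big_set0 leqn0 cards_eq0 => /eqP/setP/(_ x).
      by rewrite !inE l0 sub0set.
    by lia.
  pose f x := xchoose (l1 x).
  have lf x : l x = [set f x] by apply/eqP; exact: xchooseP (l1 x).
  exists f; split=> [x|c]; first by rewrite lf inE.
  have := hall [set c]; rewrite big_set1; congr (_ <= _).
  apply: eq_card => x.
  by rewrite !inE lf sub1set inE.
(* Deleting [c] from the list of [x] either preserves Hall's condition, so that induction applies,
   or exposes a tight set [S] into which the list of [x] fits only after the deletion. *)
have del (c : C) : c \in l x ->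
    (exists f : X -> C, (forall y, f y \in l y) /\
      (forall d, #|[set y | f y == d]| <= cap d)) \/
    exists S : {set C}, [/\ l x :\ c \subset S, c \notin S &
      #|[set y | l y \subset S]| = \sum_(d in S) cap d].
  move=> cx; pose l' y := if y == x then l x :\ c else l y.
  have l'l y : l' y \subset l y.
    by rewrite /l'; case: eqP => [->|//]; apply: subD1set.
  case: (boolP [forall S : {set C},
      #|[set y | l' y \subset S]| <= \sum_(d in S) cap d]).
    move=> /forallP hall'; left.
    have less : \sum_y #|l' y| < \sum_y #|l y|.
      rewrite (bigD1 x) //= [X in _ < X](bigD1 x) //= /l' eqxx.
      rewrite [X in _ < X + _](cardsD1 c) cx add1n addSn ltnS leq_add2l.
      by apply: leq_sum => y /negbTE ->.
    have [f [fl fc]] := IH l' (leq_trans less ltn) hall'.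
    by exists f; split=> // y; apply: subsetP (l'l y) _ (fl y).
  rewrite negb_forall => /existsP [S]; rewrite -ltnNge => bad; right.
  have lS := hall S.
  have sub : [set y | l' y \subset S] \subset x |: [set y | l y \subset S].
    by apply/subsetP=> y; rewrite !inE /l'; case: eqP.
  have xS : x \notin [set y | l y \subset S].
    apply/negP => xS; move: (subset_leq_card sub).
    rewrite (setUidPr _) ?sub1set //; lia.
  have x'S : x \in [set y | l' y \subset S].
    apply/negPn/negP => x'S; suff : #|[set y | l' y \subset S]| <=
      #|[set y | l y \subset S]| by lia.
    apply: subset_leq_card; apply/subsetP => y yl'.
    move: (subsetP sub _ yl'); rewrite in_setU1 => /orP [/eqP yx|//].
    by rewrite -yx yl' in x'S.
  move: x'S xS; rewrite !inE /l' eqxx => x'S xS.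
  exists S; split=> //.
    apply/negP => cS; case/negP: xS.
    by rewrite -(setD1K cx) subUset sub1set cS.
  have := subset_leq_card sub; rewrite cardsU1 inE xS; lia.
case/card_gt1P: xl => c1 [c2 [c1x c2x c12]].
case: (del _ c1x) => [//|[S1 [sub1 c1S eq1]]].
case: (del _ c2x) => [//|[S2 [sub2 c2S eq2]]].
have xS1 : ~~ (l x \subset S1).
  by apply: contra c1S => /subsetP; apply.
have xS2 : ~~ (l x \subset S2).
  by apply: contra c2S => /subsetP; apply.
have xU : l x \subset S1 :|: S2.
  rewrite -(setD1K c1x) subUset sub1set inE.
  rewrite (subsetP sub2) ?inE ?c12 // orbT /=.
  exact: subset_trans sub1 (subsetUl _ _).
have := hall (S1 :|: S2); have := hall (S1 :&: S2).
have := card_sub_setUI _ _ l S1 S2.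
have capU : \sum_(c in S1 :|: S2) cap c + \sum_(c in S1 :&: S2) cap c =
    \sum_(c in S1) cap c + \sum_(c in S2) cap c.
  rewrite ![\sum_(c in _) _]big_mkcond /= -!big_split /=; apply: eq_bigr => c _.
  by rewrite !inE; do 2![case: (_ \in _)]; rewrite ?addn0 ?add0n.
(* The list of [x] fits in the union but in neither tight set, so it adds one to a count that
   inclusion-exclusion already makes equal to the capacity. *)
have : #|x |: ([set y | l y \subset S1] :|: [set y | l y \subset S2])| <=
    #|[set y | l y \subset S1 :|: S2]|.
  apply: subset_leq_card; apply/subsetP => y; rewrite !inE.
  case/or3P => [/eqP -> //|/subset_trans|/subset_trans]; apply.
  - exact: subsetUl.
  - exact: subsetUr.
rewrite cardsU1 !inE (negbTE xS1) (negbTE xS2); lia.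
Qed.

(** * Counting pairs of center colors *)

(* The two sets of pairs fit in [setX U W] up to their intersection, which has
   at most one element when [T != T']; when [T = T'] it consists of pairs (c, c)
   with c in some F, and no other element of [setX F F] is in either set, so
   the claim follows from 2 * #|F| <= #|F| ^ 2 + 1. *)
Lemma card_extensions_le (C : finType) (U W : {set C}) (s : C * C -> {set C})
    (T T' : {set C}) :
  (forall p, p \in setX U W -> (p.1 \notin s p) && (p.2 \notin s p)) ->
  #|[set p in setX U W | p.1 |: s p == T]|
  + #|[set p in setX U W | p.2 |: s p == T']| <= #|U| * #|W| + 1.
Proof.
move=> avoid; set P := [set p in _ | _]; set Q := [set p in _ | _].
rewrite -cardsUI -cardsX.
have PQsub : P :|: Q \subset setX U W.
  by apply/subsetP=> p; rewrite !inE => /orP [] /andP [].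
case: (eqVneq T T') => [eqT|neT]; last first.
  apply: leq_add; first exact: subset_leq_card.
  rewrite leqNgt; apply/negP => /card_gt1P [p [q [pI qI /eqP]]]; apply.
  (* For [T != T'] the two sets determine the pair, since they differ exactly by its two colors. *)
  have inI r : r \in P :&: Q -> T :\: T' = [set r.1] /\ T' :\: T = [set r.2].
    rewrite in_setI => /andP []; rewrite in_set => /andP [rX /eqP eT].
    rewrite in_set => /andP [_ /eqP eT'].
    have /andP [r1 r2] := avoid r rX.
    have r12 : r.1 != r.2.
      by apply: contra neT => /eqP r12; rewrite -eT -eT' r12.
    rewrite -eT -eT'; split; apply/setP=> c; rewrite !inE.
      case: (eqVneq c r.1) => [->|_]; first by rewrite (negbTE r12) (negbTE r1).
      by case: (c \in s r); rewrite ?orbT ?andbF.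
    case: (eqVneq c r.2) => [->|_]; first by rewrite eq_sym (negbTE r12) (negbTE r2).
    by case: (c \in s r); rewrite ?orbT ?andbF.
  move: (inI p pI) (inI q qI) => [-> ->] [/set1_inj e1 /set1_inj e2].
  by case: p q e1 e2 {pI qI} => [? ?] [? ?] /= -> ->.
subst T'.
have inP r : r \in P -> [/\ r \in setX U W, r.1 \in T & r.2 \in T -> r.1 = r.2].
  rewrite in_set => /andP [rX /eqP <-]; have /andP [r1 r2] := avoid r rX.
  by split=> //; rewrite !inE ?eqxx // (negbTE r2) orbF => /eqP.
have inQ r : r \in Q -> [/\ r \in setX U W, r.2 \in T & r.1 \in T -> r.1 = r.2].
  rewrite in_set => /andP [rX /eqP <-]; have /andP [r1 r2] := avoid r rX.
  by split=> //; rewrite !inE ?eqxx // (negbTE r1) orbF => /eqP.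
have inI r : r \in P :&: Q -> [/\ r \in setX U W, r.1 \in T & r.1 = r.2].
  by rewrite in_setI => /andP [/inP [rX r1 r12] /inQ [_ /r12]].
pose F := [set p.1 | p in P :&: Q].
have cardF : #|F| = #|P :&: Q|.
  apply: card_in_imset => p q /inI [_ _ p12] /inI [_ _ q12] pq.
  by case: p q p12 q12 pq => [? ?] [? ?] /= <- <- ->.
have FT c : c \in F -> [/\ (c, c) \in P :&: Q, c \in U, c \in W & c \in T].
  move=> /imsetP [[c1 c2] pI -> /=]; have [] := inI _ pI.
  rewrite in_setX /= => /andP [] c1U c2W c1T c12.
  by rewrite -c12 in pI c2W.
have FFsub : setX F F \subset setX U W.
  apply/subsetP=> -[c c']; rewrite !in_setX /= => /andP [] /FT [_ -> _ _].
  by move=> /FT [].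
(* Both coordinates of a pair in [setX F F] lie in [T], which forces them to be equal once the pair
   is in [P] or [Q]. *)
have FFI : setX F F :&: (P :|: Q) \subset P :&: Q.
  apply/subsetP => -[c c']; rewrite in_setI in_setU in_setX /=.
  case/andP=> /andP [/FT [ccI _ _ cT] /FT [_ _ _ c'T]] cPQ.
  have <- // : c = c'.
  by case/orP: cPQ => [/inP [_ _]|/inQ [_ _]]; apply.
have := cardsUI (setX F F) (P :|: Q).
have : #|setX F F :|: (P :|: Q)| <= #|setX U W|.
  by apply: subset_leq_card; rewrite subUset FFsub.
have := subset_leq_card FFI; rewrite [#|setX F F|]cardsX cardF.
by nia.
Qed.

Lemma sum_card_extensions (X Y C : finType) (A : {set X}) (l : Y -> {set C})
    (t : X -> {set C}) :
  \sum_(p in A) #|[set x | l x == t p]| = \sum_x #|[set p in A | t p == l x]|.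
Proof.
under eq_bigr do rewrite -sum1_card.
under [RHS]eq_bigr do rewrite -sum1_card.
rewrite (exchange_big_dep xpredT) //=; apply: eq_bigr => x _.
by apply: eq_bigl => p; rewrite !inE eq_sym.
Qed.

(** Otherwise every pair has a bad set, and double counting bounds [#|U| * #|W| * N] by
    [#|A| * wA TA + #|B| * wB TB], where [TA] and [TB] are the lists arising from the most pairs.
    These weights sum to at most [#|U| * #|W| + 1]; as [#|A| <= #|B|], the extreme case is weight 1
    on [A] and [#|U| * #|W|] on [B]. *)
Lemma exists_center_colors (A B C : finType) (lA : A -> {set C})
    (lB : B -> {set C}) (U W : {set C}) (N : nat) :
  #|A| <= #|B| -> #|A| + #|U| * #|W| * #|B| < #|U| * #|W| * N ->
  exists c1 c2, [/\ c1 \in U, c2 \in W &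
    forall S : {set C}, c1 \notin S -> c2 \notin S ->
      #|[set x | lA x == c1 |: S]| + #|[set x | lB x == c2 |: S]| < N].
Proof.
move=> leAB few.
pose bad p (S : {set C}) := [&& p.1 \notin S, p.2 \notin S &
  N <= #|[set x | lA x == p.1 |: S]| + #|[set x | lB x == p.2 |: S]|].
case: (boolP [exists p in setX U W, [forall S, ~~ bad p S]]).
  case/exists_inP => -[c1 c2]; rewrite in_setX /= => /andP [c1U c2W] /forallP ok.
  exists c1, c2; split=> // S c1S c2S.
  by move: (ok S); rewrite /bad /= c1S c2S /= -ltnNge.
rewrite negb_exists_in => /forall_inP allbad; exfalso.
pose s p := odflt set0 [pick S | bad p S].
have sbad p : p \in setX U W -> bad p (s p).
  move=> /allbad; rewrite negb_forall /s => /existsP [S].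
  by rewrite negbK; case: pickP => //= ->.
have avoid p : p \in setX U W -> (p.1 \notin s p) && (p.2 \notin s p).
  by move=> /sbad /and3P [-> ->].
pose wA T := #|[set p in setX U W | p.1 |: s p == T]|.
pose wB T := #|[set p in setX U W | p.2 |: s p == T]|.
have sT0 : 0 < #|{set C}| by apply/card_gt0P; exists set0.
have [TA eA] := eq_bigmax wA sT0; have [TB eB] := eq_bigmax wB sT0.
have := card_extensions_le _ U W s TA TB avoid.
rewrite -/(wA TA) -/(wB TB) => wAB.
have : \sum_(p in setX U W) N <= \sum_x wA (lA x) + \sum_x wB (lB x).
  rewrite -!sum_card_extensions -big_split /=; apply: leq_sum => p.
  by move=> /sbad /and3P [].
have : \sum_x wA (lA x) <= #|A| * wA TA.
  by rewrite -sum_nat_const; apply: leq_sum => x _; rewrite -eA leq_bigmax.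
have : \sum_x wB (lB x) <= #|B| * wB TB.
  by rewrite -sum_nat_const; apply: leq_sum => x _; rewrite -eB leq_bigmax.
rewrite sum_nat_const cardsX.
have : wB TB <= #|U| * #|W|.
  by rewrite -cardsX; apply: subset_leq_card; apply/subsetP=> p /setIdP [].
move: few wAB leAB; set u := _ * #|W|; set b := wB TB.
(* If [wA TA] is positive, all but one unit of it is shifted to the side of [B]. *)
case: (wA TA) => [|a] few wAB leAB leb sumB sumA total.
  have : #|B| * b <= #|B| * u by rewrite leq_mul2l leb orbT.
  by lia.
have : #|A| * a <= #|B| * a by rewrite leq_mul2r leAB orbT.
have : #|B| * (a + b) <= #|B| * u by rewrite leq_mul2l; apply/orP; right; lia.
by rewrite mulnDr; lia.
Qed.

(** * Cardinalities and rounding *)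

Lemma card_set_sum (A B : finType) (P : pred (A + B)) :
  #|[set v | P v]| = #|[set a | P (inl a)]| + #|[set b | P (inr b)]|.
Proof.
rewrite -!sum1_card big_sumType /=.
by congr (_ + _); apply: eq_bigl => x; rewrite !inE.
Qed.

Lemma card_set_ord1 (b : bool) : #|[set _ : 'I_1 | b]| = b.
Proof.
case: b; last by apply: eq_card0 => i; rewrite inE.
by rewrite -[RHS](card_ord 1); apply: eq_card => i; rewrite inE.
Qed.

(** A list of size [k] inside a set of size at most [k] fills it. *)
Lemma set_subset_setD1 (X C : finType) (k : nat) (l : X -> {set C}) (c : C)
    (S : {set C}) :
  (forall x, #|l x| = k) -> #|c |: S| <= k ->
  [set x | l x :\ c \subset S] = [set x | l x == c |: S].
Proof.
by move=> lk cS; apply/setP=> x; rewrite !inE subDset eqEcard lk cS andbT.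
Qed.

Lemma ceil_div_mul_ge (n k : nat) :
  0 < k -> (n%:Z <= ceil_div n k * k%:Z)%R.
Proof.
move=> k0; have := ceil_ge (n%:R / k%:R : rat)%R.
rewrite ler_pdivrMr ?ltr0n //.
by rewrite !pmulrn -intrM ler_int.
Qed.

Lemma ceil_div_ge0 (n k : nat) : (0 <= ceil_div n k)%R.
Proof.
rewrite ceil_ge0.
apply: (@Order.POrderTheory.lt_le_trans _ _ 0%R) => //.
by rewrite divr_ge0 // ler0n.
Qed.

(** * Coloring the two stars *)

Theorem theorem1p7 (k m1 m2 : nat) :
  let rho : int := ceil_div (m1 + m2 + 2) k in
  0 < k -> 1 <= m1 -> m1 <= m2 ->
  (m2%:Z <= rho * (k%:Z - 1) - 1)%R ->
  (m1%:Z + m2%:Z <= 15%:Z + rho * (k%:Z - 2%:Z))%R ->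
  equitably_choosable k
    (disjoint_union (complete_bipartite 1 m1) (complete_bipartite 1 m2)).
Proof.
set G := disjoint_union _ _.
move=> rho k0 m1_gt0 m12 cond1 cond2 C L kL.
have [r rE] : exists r : nat, rho = r%:Z%R.
  have := ceil_div_ge0 (m1 + m2 + 2) k; rewrite -/rho.
  by case: (rho) => // r _; exists r.
have k1 : 1 < k.
  rewrite leqNgt; apply/negP => k1; have k_eq1 : k = 1 by lia.
  by move: cond1; rewrite k_eq1 subrr mulr0; lia.
have := ceil_div_mul_ge (m1 + m2 + 2) k k0.
rewrite -/rho rE => n_le; rewrite rE in cond1 cond2.
have [k' kE] : exists k', k = k'.+2 by exists (k - 2); lia.
have {}n_le : m1 + m2 + 2 <= r * k'.+2 by rewrite kE in n_le; lia.
have {}cond1 : m2 + 1 <= r * k'.+1 by rewrite kE in cond1; lia.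
have {}cond2 : m1 + m2 <= 15 + r * k' by rewrite kE in cond2; lia.
pose U := L (inl (inl ord0)); pose W := L (inr (inl ord0)).
pose lA (x : 'I_m1) := L (inl (inr x)); pose lB (x : 'I_m2) := L (inr (inr x)).
have [c1 [c2 [c1U c2W c12 ok]]] : exists c1 c2, [/\ c1 \in U, c2 \in W,
    c1 != c2 \/ 2 <= r & forall S : {set C}, c1 \notin S -> c2 \notin S ->
    #|[set x | lA x == c1 |: S]| + #|[set x | lB x == c2 |: S]| <= r * k'.+1].
  have [r2|r1] := leqP 2 r.
    have [] := @exists_center_colors _ _ _ lA lB U W (r * k'.+1).+1.
    - by rewrite !card_ord.
    - have [q qE q3] : exists2 q, #|U| * #|W| = q.+1 & 3 <= q.
        by exists (k'.+2 * k'.+2).-1; rewrite ?kL ?kE; nia.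
      rewrite !card_ord qE.
      have : q * (m2 + 1) <= q * (r * k'.+1) by rewrite leq_mul2l cond1 orbT.
      (* Adding [n_le] and [cond2] cancels the deviations by [r] from [r * k'.+1] and gives
         [m1 + m2 <= r * k'.+1 + 6]; with [m2 + 1 <= r * k'.+1], the bound [3 <= q] then
         suffices. *)
      by lia.
    - move=> c1 [c2 [c1U c2W ok]]; exists c1, c2; split=> //; first by right.
  (* With capacity 1 the centers need distinct colors, but there are at most [k'] leaves in all, so
     no set [S] is an obstacle. *)
  have r_eq1 : r = 1 by case: (r) r1 cond1 => [|[]] //; lia.
  have /card_gt0P [c1 c1U] : 0 < #|U| by rewrite kL.
  have /card_gt0P [c2] : 0 < #|W :\ c1|.
    by have := cardsD1 c1 W; rewrite kL; lia.
  rewrite !inE eq_sym => /andP [c12 c2W]; exists c1, c2; split=> //.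
    by left.
  move=> S _ _; apply: (@leq_trans (m1 + m2)).
    by apply: leq_add; rewrite -[X in _ <= X]card_ord max_card.
  by rewrite r_eq1 in n_le *; lia.
have r0 : 0 < r by case: (r) cond1 => [|//]; lia.
have kA x : #|lA x| = k by rewrite kL.
have kB x : #|lB x| = k by rewrite kL.
(* Removing the center's color from the leaf lists makes every choice from [l] proper. *)
pose l (v : G) : {set C} := match v with
  | inl (inl _) => [set c1] | inl (inr x) => lA x :\ c1
  | inr (inl _) => [set c2] | inr (inr x) => lB x :\ c2 end.
have cardG : #|G| = m1 + m2 + 2 by rewrite !card_sum !card_ord; lia.
have [|f [fl fr]] := @hall_capacity G C (fun=> r) l.
  move=> S; rewrite sum_nat_const.
  have [kS|Sk] := leqP k #|S|.
    apply: leq_trans (max_card _) _; rewrite cardG; apply: leq_trans n_le _.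
    by rewrite mulnC leq_mul2r -kE kS orbT.
  have cS c : #|c |: S| <= k by rewrite cardsU1; case: (_ \notin _); lia.
  rewrite !card_set_sum /= !card_set_ord1 !sub1set.
  rewrite (set_subset_setD1 _ _ _ _ _ _ kA) // (set_subset_setD1 _ _ _ _ _ _ kB) //.
  have small (X : finType) (h : X -> {set C}) c : (forall x, #|h x| = k) ->
      #|c |: S| < k -> #|[set x | h x == c |: S]| = 0.
    move=> hk small; apply: eq_card0 => x; rewrite !inE.
    by apply: contraTF small => /eqP <-; rewrite hk ltnn.
  have := small _ _ c1 kA; have := small _ _ c2 kB; rewrite !cardsU1.
  have := max_card [set x | lA x == c1 |: S].
  have := max_card [set x | lB x == c2 |: S].
  have := ok S; rewrite !card_ord.
  set a := #|[set x | _ == c1 |: S]|; set b := #|[set x | _ == c2 |: S]|.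
  have Sr : #|S| <= #|S| * r by rewrite leq_pmulr.
  have Sfull : #|S| < k'.+1 \/ #|S| * r = r * k'.+1.
    rewrite mulnC; case: ltngtP => [|Sgt|->]; [by left| |by right].
    by move: Sgt Sk; rewrite kE; lia.
  have S1 c : c \in S -> 0 < #|S| by move=> cSin; apply/card_gt0P; exists c.
  (* A star whose center color is in [S] contributes only its center; any other star contributes
     only leaves, and these only if [#|S|] is [k'.+1]. With one color outside [S], [cond1] leaves
     room for the center; with both outside, [ok] applies. *)
  case: (boolP (c1 \in S)) => c1S; case: (boolP (c2 \in S)) => c2S /=.
  - move=> _ _ _ b0 a0; rewrite a0 // b0 //.
    case: c12 => [c12|r2]; last by have := S1 _ c1S; nia.
    by apply: leq_trans Sr; apply/card_gt1P; exists c1, c2.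
  - move=> _ lb _ b0 a0; rewrite a0 //; have := S1 _ c1S.
    by case: Sfull => [Slt|->]; [rewrite b0|]; lia.
  - move=> _ _ la b0 a0; rewrite b0 //; have := S1 _ c2S.
    by case: Sfull => [Slt|->]; [rewrite a0|]; lia.
  - move=> /(_ isT isT) ab _ _ b0 a0.
    by case: Sfull => [Slt|->]; [rewrite a0 ?b0|]; lia.
exists f; split; [split|].
- have fu i : f (inl (inl i)) = c1 by apply/set1P; apply: (fl (inl (inl i))).
  have fw i : f (inr (inl i)) = c2 by apply/set1P; apply: (fl (inr (inl i))).
  have fA x : f (inl (inr x)) <> c1.
    by have := fl (inl (inr x)); rewrite !inE => /andP [/eqP].
  have fB x : f (inr (inr x)) <> c2.
    by have := fl (inr (inr x)); rewrite !inE => /andP [/eqP].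
  move=> [[i|x]|[i|x]] [[j|y]|[j|y]] //= _; rewrite ?fu ?fw.
  + by move/esym/fA.
  + exact: fA.
  + by move/esym/fB.
  + exact: fB.
- move=> v; have := fl v; case: v => [[i|x]|[i|x]] /=.
  + by rewrite inE => /eqP ->; rewrite (ord1 i).
  + by rewrite inE => /andP [].
  + by rewrite inE => /eqP ->; rewrite (ord1 i).
  + by rewrite inE => /andP [].
- by move=> c _; rewrite cardG -/rho rE lez_nat.
Qed.
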